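(* Let $\Gamma=(V,E,\ell)$ be a finite labeled simplicial graph with all labels even, $\mathbb{K}$ a field, and $\chi:A_\Gamma\to\mathbb{Z}$ a nonzero homomorphism with Artin kernel $A^\chi_\Gamma=\ker\chi$. Then the rank of the free part of the $\mathbb{K}[t^{\pm1}]$-module $H_1(A^\chi_\Gamma;\mathbb{K})$ equals $\dim_{\mathbb{K}}\tilde H_0(\Gamma_1;\mathbb{K})$. In particular, $H_1(A^\chi_\Gamma;\mathbb{K})$ is a torsion module if and only if $\Gamma_1$ is connected.
   Context: $\Gamma=(V,E,\ell)$: finite simplicial graph, labels $\ell(e)=2\tilde\ell(e)$, $\tilde\ell(e)\ge1$; $A_\Gamma=\langle g_v\ (v\in V)\mid (g_vg_w)^{\tilde\ell(e)}=(g_wg_v)^{\tilde\ell(e)},\ e=\{v,w\}\in E\rangle$. Write $m_v=\chi(g_v)$ and $m_e=m_v+m_w$ for $e=\{v,w\}\in E$. $H_1(A^\chi_\Gamma;\mathbb{K})$ is a $\mathbb{K}[t^{\pm1}]$-module, $t$ acting via the automorphism induced by conjugation by an element $g\in A_\Gamma$ such that $\chi(g)$ generates $\operatorname{im}\chi$. The resonance sets are $V_{\mathcal R}=\{v\in V: m_v=0\}$ and $E_{\mathcal R}=\{e\in E: m_e=0\text{ and }\tilde\ell(e)\cdot1_{\mathbb{K}}=0\}$. The graph $\Gamma_1$ is obtained from $\Gamma$ by deleting the (open) edges $e=\{v,w\}\in E$ for which either $v,w\in V_{\mathcal R}$ or $e\in E_{\mathcal R}$, and deleting (with their incident edges) the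 vertices $v\in V_{\mathcal R}$ that are adjacent in $\Gamma$ to some vertex of $V\setminus V_{\mathcal R}$. $\tilde H_0(\Gamma_1;\mathbb{K})$ is reduced $0$-th homology of $\Gamma_1$ viewed as a $1$-dimensional complex. *)

(* Defs.v *)
From mathcomp Require Import all_boot all_order all_algebra.
Set Implicit Arguments. Unset Strict Implicit. Unset Printing Implicit Defensive.
Import Order.TTheory GRing.Theory Num.Theory.
Local Open Scope ring_scope.

(* (v, false) is the letter g_v, (v, true) is g_v^{-1}. *)
Definition word (V : Type) := seq (V * bool).

Definition winv (V : Type) (w : word V) : word V :=
  rev (map (fun p => (p.1, ~~ p.2)) w).

Definition wpow (V : Type) (w : word V) (n : nat) : word V := flatten (nseq n w).

Definition artin_rel (V : Type) (v w : V) (n : nat) : word V :=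
  wpow [:: (v, false); (w, false)] n.

(* Equality in the even Artin group A_Gamma: the congruence on words generated
   by free cancellation and the relations (g_v g_w)^{lt e} = (g_w g_v)^{lt e}
   for edges e = {v,w}; here lt = \tilde\ell, i.e. the label is 2 * lt. *)
Inductive aeq (V : Type) (adj : rel V) (lt : V -> V -> nat) : word V -> word V -> Prop :=
| aeq_refl u : aeq adj lt u u
| aeq_sym u w : aeq adj lt u w -> aeq adj lt w u
| aeq_trans u w x : aeq adj lt u w -> aeq adj lt w x -> aeq adj lt u x
| aeq_ctx a b u w : aeq adj lt u w -> aeq adj lt (a ++ u ++ b) (a ++ w ++ b)
| aeq_free v b : aeq adj lt [:: (v, b); (v, ~~ b)] [::]
| aeq_artin v w : adj v w ->
    aeq adj lt (artin_rel v w (lt v w)) (artin_rel w v (lt v w)).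

Definition chi (V : Type) (m : V -> int) (w : word V) : int :=
  \sum_(p <- w) (if p.2 then - m p.1 else m p.1).

(* ---------- H_1(A^chi; K) = (A^chi)_ab (x) K ---------- *)
(* Chains: finite formal K-combinations of words (elements of the kernel). *)
Section H1.
Variables (V : eqType) (adj : rel V) (lt : V -> V -> nat) (m : V -> int)
          (K : fieldType).

Definition chain := seq (K * word V).

Definition coef (c : chain) (w : word V) : K := \sum_(p <- c | p.2 == w) p.1.

Definition is_chain (c : chain) : bool := all (fun p => chi m p.2 == 0) c.

(* Generators of the kernel of  K[A^chi] -> H_1(A^chi;K) (K-span):
   [u] + [w] - [uw] for u, w in A^chi, and [u] - [w] for u = w in A_Gamma. *)
Inductive h1rel : chain -> Prop :=
| h1rel_nil : h1rel [::]
| h1rel_mul a u w : chi m u = 0 -> chi m w = 0 ->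
    h1rel [:: (a, u); (a, w); (- a, u ++ w)]
| h1rel_eq a u w : chi m u = 0 -> aeq adj lt u w ->
    h1rel [:: (a, u); (- a, w)]
| h1rel_cat c c' : h1rel c -> h1rel c' -> h1rel (c ++ c').

Definition h1zero (c : chain) : Prop :=
  exists r, h1rel r /\ forall w, coef c w = coef r w.

Definition scalec (a : K) (c : chain) : chain := map (fun p => (a * p.1, p.2)) c.

Definition conjc (h : word V) (k : nat) (c : chain) : chain :=
  map (fun p => (p.1, wpow h k ++ p.2 ++ winv (wpow h k))) c.

(* Laurent polynomial t^{-n} p(t) in K[t^{+-1}] represented as (n, p);
   it is zero iff p = 0. *)
Definition laurent := (nat * {poly K})%type.

(* Action of K[t^{+-1}] where t acts by conjugation by g. *)
Definition lact (g : word V) (l : laurent) (c : chain) : chain :=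
  flatten [seq scalec l.2`_i (conjc g i (conjc (winv g) l.1 c))
          | i <- iota 0 (size l.2)].

Definition h1_independent (g : word V) (cs : seq chain) : Prop :=
  all is_chain cs /\
  forall ls : seq laurent, size ls = size cs ->
    h1zero (flatten [seq lact g lc.1 lc.2 | lc <- zip ls cs]) ->
    all (fun l => l.2 == 0) ls.

Definition h1_rank_is (g : word V) (r : nat) : Prop :=
  (exists cs, h1_independent g cs /\ size cs = r) /\
  (forall cs, h1_independent g cs -> (size cs <= r)%N).

Definition h1_torsion (g : word V) : Prop :=
  forall c, is_chain c -> exists l : laurent, l.2 != 0 /\ h1zero (lact g l c).
End H1.

Section Gamma1.
Variables (V : finType) (adj : rel V) (lt : V -> V -> nat) (m : V -> int)
          (K : fieldType).

Definition VR (v : V) : bool := m v == 0.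
Definition ER (v w : V) : bool := (m v + m w == 0) && ((lt v w)%:R == 0 :> K).

Definition V1 : pred V := fun v => ~~ (VR v && [exists w, adj v w && ~~ VR w]).
Definition E1 : rel V := fun v w =>
  [&& adj v w, V1 v, V1 w, ~~ (VR v && VR w) & ~~ ER v w].

Definition ncomp_Gamma1 : nat := n_comp E1 V1.
End Gamma1.

(* Main.v *)
From HB Require Import structures.
Require Import Defs.
From mathcomp Require Import all_boot all_order all_algebra.
From mathcomp Require Import boolp freeg.
Set Implicit Arguments. Unset Strict Implicit. Unset Printing Implicit Defensive.
Import GRing.Theory Num.Theory.
Local Open Scope ring_scope.
Local Open Scope quotient_scope.

(** Rescaling [m], assume that [chi m g = 1], and let [F] be the fraction field
    of [K[t]].  The class [[u]] of [u g^(- chi u)] satisfies the cocycle rule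
    [[u w] = [u] + t^(chi u) [w]]; so, over [F], [H_1] is generated by the
    [[g_v]], and the coordinates of [[u]] are the Fox derivatives of [u].  The
    relations are [[g] = 0] and, for each edge [{v, w}],
      [N ((1 - t^(m w)) [g_v] - (1 - t^(m v)) [g_w]) = 0]
    with [N = sum_(i < lt v w) t^(i (m v + m w))], where [N = 0] exactly on
    [E_R].  The edge relations identify suitable multiples of the generators
    along the edges of [Gamma_1] and kill the generators of the deleted
    vertices, which leaves one dimension for each component of [Gamma_1].  The
    row functional [g_v |-> 1 - t^(m v)] takes the value [1 - t^(chi u)] at the
    Fox derivatives of [u] (the fundamental formula of Fox calculus); it
    vanishes on the edge relations but not on [g], so the relation [[g] = 0]
    cuts the dimension by exactly one. *)

Section ModuleRank.
Variables (R : idomainType) (M : lmodType R).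

Definition free_family n (y : 'I_n -> M) : Prop :=
  forall a : 'I_n -> R, \sum_i a i *: y i = 0 -> forall i, a i = 0.

Lemma free_family_cast n n' (e : n' = n) (y : 'I_n -> M) :
  free_family y -> free_family (y \o cast_ord e).
Proof.
case: n / e y => y y_free a ya0; apply: y_free; rewrite -[RHS]ya0.
by apply: eq_bigr => i _ /=; rewrite cast_ord_id.
Qed.

Definition module_rank_is (r : nat) : Prop :=
  (exists y : 'I_r -> M, free_family y) /\
  (forall n (y : 'I_n -> M), free_family y -> (n <= r)%N).

Definition torsion_module : Prop :=
  forall y : M, exists2 p : R, p != 0 & p *: y = 0.

Lemma torsion_module_rank r : module_rank_is r -> torsion_module <-> r = 0%N.
Proof.
move=> [[y y_free] rank_max]; split=> [M_torsion | r0 z].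
  case: r y y_free {rank_max} => // r y y_free.
  have [p /eqP p_neq0 py0] := M_torsion (y ord0).
  case: p_neq0; have := y_free (fun i => if i == ord0 then p else 0).
  rewrite big_ord_recl big1 ?addr0 => [/(_ py0 ord0) //| i _].
  by rewrite scale0r.
apply: contrapT => z_not_torsion.
suff /rank_max : free_family (fun _ : 'I_1 => z) by rewrite r0.
move=> a; rewrite big_ord1 => az0 i; rewrite [i]ord1; apply: contrapT => /eqP a0.
by apply: z_not_torsion; exists (a ord0).
Qed.

End ModuleRank.

Section RankOfPresentation.
Variable R : idomainType.
Local Notation F := {fraction R}.
Local Notation "x %:F" := (@FracField.tofrac _ x).
Local Notation tofrac := (@FracField.tofrac R).

Lemma fraction_denominator (a : F) : exists d n : R, d != 0 /\ d%:F * a = n%:F.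
Proof.
elim/quotW: a => a; exists \d_a, \n_a; split; first exact: denom_ratioP.
have d_neq0 := denom_ratioP a.
rewrite -[_ * _]/(FracField.mul _ _) !piE; apply/eqmodP.
rewrite /= FracField.equivfE !numden_Ratio ?mulf_neq0 ?oner_neq0 //.
by rewrite mul1r mulr1 mulrC.
Qed.

Lemma row_common_denominator n (q : 'rV[F]_n) :
  exists (p : R) (a : 'rV[R]_n), p != 0 /\ map_mx tofrac a = p%:F *: q.
Proof.
have [d dP] := fin_all_exists (fun i => fraction_denominator (q 0 i)).
have [c {}dP] := fin_all_exists dP.
exists (\prod_i d i), (\row_i (c i * \prod_(j | j != i) d j)); split.
  by rewrite prodf_seq_neq0; apply/allP => i _; have [] := dP i.
apply/rowP => i; have [_ di] := dP i.
by rewrite !mxE [in RHS](bigD1 i) //= !tofracM -di mulrAC.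
Qed.

Variables (M : lmodType R) (n : nat) (x : 'I_n -> M).

(* [y] equals the combination of the [x i] with coefficients [q] after
   extension of scalars from [R] to its field of fractions. *)
Definition frac_coord (y : M) (q : 'rV[F]_n) : Prop :=
  exists (p : R) (a : 'rV[R]_n),
    [/\ p != 0, map_mx tofrac a = p%:F *: q & p *: y = \sum_i a 0 i *: x i].

Lemma frac_coord_sum_gen (a : 'rV[R]_n) :
  frac_coord (\sum_i a 0 i *: x i) (map_mx tofrac a).
Proof. by exists 1, a; rewrite oner_neq0 rmorph1 !scale1r. Qed.

Lemma frac_coord0 : frac_coord 0 0.
Proof.
have := frac_coord_sum_gen 0; rewrite map_mx0 big1 // => i _.
by rewrite mxE scale0r.
Qed.

Lemma frac_coord_gen i : frac_coord (x i) (delta_mx 0 i).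
Proof.
have := frac_coord_sum_gen (delta_mx 0 i); rewrite map_delta_mx.
rewrite (bigD1 i) //= mxE !eqxx scale1r big1 ?addr0 // => j /negPf ji.
by rewrite mxE ji andbF scale0r.
Qed.

Lemma frac_coordD y q z r :
  frac_coord y q -> frac_coord z r -> frac_coord (y + z) (q + r).
Proof.
move=> [p [a [p0 aE yE]]] [s [b [s0 bE zE]]].
exists (p * s), (s *: a + p *: b); split; first exact: mulf_neq0.
  rewrite map_mxD !map_mxZ aE bE !scalerA.
  by rewrite [in RHS]tofracM scalerDr [s%:F * _]mulrC.
rewrite scalerDr {1}mulrC -!scalerA yE zE !scaler_sumr -big_split /=.
by apply: eq_bigr => i _; rewrite !mxE scalerDl !scalerA.
Qed.

Lemma frac_coordZ c y q : frac_coord y q -> frac_coord (c *: y) (c%:F *: q).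
Proof.
move=> [p [a [p0 aE yE]]]; exists p, (c *: a); split=> //.
  by rewrite map_mxZ aE !scalerA mulrC.
rewrite scalerA mulrC -scalerA yE scaler_sumr.
by apply: eq_bigr => i _; rewrite mxE scalerA.
Qed.

Lemma frac_coordN y q : frac_coord y q -> frac_coord (- y) (- q).
Proof. by move/(frac_coordZ (-1)); rewrite rmorphN1 !scaleN1r. Qed.

Lemma frac_coordB y q z r :
  frac_coord y q -> frac_coord z r -> frac_coord (y - z) (q - r).
Proof. by move=> yq /frac_coordN; apply: frac_coordD. Qed.

Lemma frac_coordZK c y q :
  c != 0 -> frac_coord (c *: y) (c%:F *: q) -> frac_coord y q.
Proof.
move=> c0 [p [a [p0 aE yE]]]; exists (p * c), a; split.
- exact: mulf_neq0.
- by rewrite aE scalerA rmorphM.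
- by rewrite -scalerA.
Qed.

Lemma frac_coord_torsion y : frac_coord y 0 -> exists2 p : R, p != 0 & p *: y = 0.
Proof.
move=> [p [a [p0 aE yE]]]; exists p => //; rewrite yE big1 // => i _.
have /rowP/(_ i)/eqP := aE; rewrite scaler0 !mxE tofrac_eq0 => /eqP ->.
by rewrite scale0r.
Qed.

Lemma frac_coord0Z (c : F) q : frac_coord 0 q -> frac_coord 0 (c *: q).
Proof.
have [d [b [d0 dc]]] := fraction_denominator c => /(frac_coordZ b).
by rewrite scaler0 => bq; apply: (@frac_coordZK d); rewrite // scaler0 scalerA dc.
Qed.

Lemma frac_coord0_rV q r : (r <= q)%MS -> frac_coord 0 q -> frac_coord 0 r.
Proof. by move=> /sub_rVP[c ->]; apply: frac_coord0Z. Qed.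

Lemma frac_coord0_sums (I : finType) (P : pred I) (A : I -> 'rV_n) q :
  (forall i, P i -> frac_coord 0 (A i)) ->
  (q <= \sum_(i | P i) <<A i>>)%MS -> frac_coord 0 q.
Proof.
move=> A0 /sub_sumsmxP[u ->]; elim/big_ind: _ => [|q1 q2 q1_0 q2_0|i /A0].
- exact: frac_coord0.
- by rewrite -[0]addr0; apply: frac_coordD.
- by apply: frac_coord0_rV; rewrite -(genmxE (A i)) submxMl.
Qed.

Lemma frac_coord_lincomb k (y : 'I_k -> M) (Q : 'M_(k, n)) (a : 'rV_k) :
  (forall i, frac_coord (y i) (row i Q)) ->
  frac_coord (\sum_i a 0 i *: y i) (map_mx tofrac a *m Q).
Proof.
move=> yQ; rewrite mulmx_sum_row.
elim/big_ind2: _ => [|y1 q1 y2 q2|i _]; first exact: frac_coord0.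
  exact: frac_coordD.
by rewrite mxE; apply/frac_coordZ/yQ.
Qed.

Variables (k : nat) (N : 'M[F]_(k, n)).
Hypothesis x_generates : forall y, exists q, frac_coord y q.
Hypothesis relations_N : forall q, frac_coord 0 q <-> (q <= N)%MS.

Lemma free_family_row_free l (y : 'I_l -> M) (Q : 'M_(l, n)) :
  (forall i, frac_coord (y i) (row i Q)) ->
  free_family y <-> row_free (Q *m cokermx N).
Proof.
move=> yQ; split=> [y_free | Q_free a ya0].
- apply: inj_row_free => v; rewrite mulmxA => /eqP; rewrite -submxE => vQN.
  have [d [b [d0 bE]]] := row_common_denominator v.
  have b_rel : frac_coord 0 (map_mx tofrac b *m Q).
    by apply/relations_N; rewrite bE -scalemxAl scalemx_sub.
  have := frac_coordB (frac_coord_lincomb b yQ) b_rel; rewrite subr0 subrr.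
  move=> /frac_coord_torsion[p p0]; rewrite scaler_sumr => pb0.
  have b0 i : b 0 i = 0.
    apply/eqP; have := y_free (fun i => p * b 0 i).
    under eq_bigr => j _ do rewrite -scalerA.
    by move=> /(_ pb0 i)/eqP; rewrite mulf_eq0 (negPf p0).
  apply/rowP => i; move/rowP/(_ i)/eqP: bE.
  by rewrite !mxE b0 rmorph0 eq_sym mulf_eq0 tofrac_eq0 (negPf d0) => /eqP.
- pose v : 'rV_l := \row_i a i.
  have := frac_coord_lincomb v yQ; under eq_bigr => i _ do rewrite mxE.
  rewrite ya0 => /relations_N; rewrite submxE -mulmxA mulmx_free_eq0 // => /eqP v0 i.
  by move/rowP/(_ i)/eqP: v0; rewrite !mxE tofrac_eq0 => /eqP.
Qed.

Theorem presentation_rank : module_rank_is M (n - \rank N).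
Proof.
rewrite -mxrank_coker; split.
  pose f := maxrankfun (cokermx N); exists (x \o f).
  apply/(@free_family_row_free _ _ (rowsub f 1%:M)).
    by move=> i; rewrite row_rowsub row1; apply: frac_coord_gen.
  by rewrite mul_rowsub_mx mul1mx maxrowsub_free.
move=> l y; have [q yq] := fin_all_exists (fun i => x_generates (y i)).
move=> /(@free_family_row_free _ _ (\matrix_i q i)) y_free.
have /eqP <- : row_free ((\matrix_i q i) *m cokermx N).
  by apply: y_free => i; rewrite rowK.
exact: mxrankM_maxr.
Qed.

End RankOfPresentation.

Definition restrict_scalars (R S : nzRingType) (s : {rmorphism R -> S})
  (W : lmodType S) : Type := W.

Section RestrictionOfScalars.
Variables (R S : nzRingType) (s : {rmorphism R -> S}) (W : lmodType S).
Local Notation sW := (restrict_scalars s W).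

HB.instance Definition _ := GRing.Zmodule.on sW.

Let scale (a : R) (w : sW) : sW := s a *: (w : W).

Let scaleA a b w : scale a (scale b w) = scale (a * b) w.
Proof. by rewrite /scale scalerA rmorphM. Qed.

Let scale1 : left_id 1 scale.
Proof. by move=> w; rewrite /scale rmorph1 scale1r. Qed.

Let scaleDr : right_distributive scale +%R.
Proof. by move=> a v w; rewrite /scale scalerDr. Qed.

Let scaleDl w : {morph scale^~ w : a b / a + b}.
Proof. by move=> a b; rewrite /scale rmorphD scalerDl. Qed.

HB.instance Definition _ :=
  GRing.Zmodule_isLmodule.Build R sW scaleA scale1 scaleDr scaleDl.

Lemma restrict_scalarsE a (w : sW) : a *: w = s a *: (w : W).
Proof. by []. Qed.

End RestrictionOfScalars.

Definition poly_module (R : nzRingType) (W : lmodType R)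
  (phi : {linear W -> W}) : Type := W.

Section PolynomialModuleOfEndomorphism.
Variables (R : nzRingType) (W : lmodType R) (phi : {linear W -> W}).

Definition poly_act (p : {poly R}) (w : W) : W :=
  \sum_(i < size p) p`_i *: iter i phi w.

Lemma poly_act_widen (p : {poly R}) w n : (size p <= n)%N ->
  poly_act p w = \sum_(i < n) p`_i *: iter i phi w.
Proof.
move=> le_pn; rewrite /poly_act (big_ord_widen _ (fun i => p`_i *: iter i phi w) le_pn).
rewrite big_mkcond; apply: eq_bigr => i _; case: ltnP => // le_pi.
by rewrite nth_default ?scale0r.
Qed.

Lemma poly_actDl w : {morph poly_act^~ w : p q / p + q}.
Proof.
move=> p q; pose n := maxn (size p) (size q).
rewrite !(@poly_act_widen _ _ n) ?leq_maxl ?leq_maxr //.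
  by rewrite -big_split; apply: eq_bigr => i _; rewrite coefD scalerDl.
exact: size_polyD.
Qed.

Lemma poly_actZ c p w : poly_act (c *: p) w = c *: poly_act p w.
Proof.
rewrite (poly_act_widen _ (size_scale_leq c p)) scaler_sumr.
by apply: eq_bigr => i _; rewrite coefZ scalerA.
Qed.

Lemma poly_actC c w : poly_act c%:P w = c *: w.
Proof. by rewrite (poly_act_widen _ (size_polyC_leq1 c)) big_ord1 coefC. Qed.

Lemma poly_actMX p w : poly_act (p * 'X) w = phi (poly_act p w).
Proof.
rewrite (@poly_act_widen _ _ (size p).+1); last first.
  by rewrite (leq_trans (size_polyMleq _ _)) ?size_polyX ?addn2.
rewrite big_ord_recl coefMX scale0r add0r linear_sum.
by apply: eq_bigr => i _; rewrite coefMX linearZ.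
Qed.

Lemma poly_actA p q w : poly_act p (poly_act q w) = poly_act (p * q) w.
Proof.
elim/poly_ind: p => [|p c IH]; first by rewrite mul0r /poly_act size_poly0 !big_ord0.
rewrite mulrDl mul_polyC -mulrA -commr_polyX mulrA !poly_actDl !poly_actMX.
by rewrite poly_actC poly_actZ IH.
Qed.

Lemma poly_act1 : left_id 1 poly_act.
Proof. by move=> w; rewrite -polyC1 poly_actC scale1r. Qed.

Lemma poly_actDr : right_distributive poly_act +%R.
Proof.
move=> p v w; rewrite /poly_act -big_split; apply: eq_bigr => i _.
rewrite /= -scalerDr; congr (_ *: _).
by elim: (i : nat) => //= j ->; rewrite linearD.
Qed.

Local Notation pW := (poly_module phi).

HB.instance Definition _ := GRing.Zmodule.on pW.
HB.instance Definition _ :=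
  GRing.Zmodule_isLmodule.Build {poly R} pW poly_actA poly_act1 poly_actDr poly_actDl.

Lemma poly_moduleE p (w : pW) : p *: w = \sum_(i < size p) p`_i *: (iter i phi w : W).
Proof. by []. Qed.

Lemma poly_moduleC c (w : pW) : c%:P *: w = c *: (w : W).
Proof. exact: poly_actC. Qed.

Lemma poly_moduleX (w : pW) : 'X *: w = phi w.
Proof. by rewrite -['X]mul1r -[_ *: _]/(poly_act _ _) poly_actMX poly_act1. Qed.

Lemma poly_moduleXn n (w : pW) : 'X^n *: w = iter n phi w.
Proof.
elim: n => [|n IH]; first by rewrite scale1r.
by rewrite exprS -scalerA IH poly_moduleX.
Qed.

Lemma scaler_closed_poly_module (S : addrClosed W) :
  (forall c w, w \in S -> c *: w \in S) -> (forall w, w \in S -> phi w \in S) ->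
  forall (p : {poly R}) (w : pW), w \in S -> p *: w \in S.
Proof.
move=> SZ Sphi p w Sw; rewrite poly_moduleE rpred_sum // => i _; apply: SZ.
by elim: (i : nat) => //= j; apply: Sphi.
Qed.

Lemma poly_module_semilinear (L : nzRingType) (s : {rmorphism {poly R} -> L})
    (Y : lmodType L) (f : {additive W -> Y}) :
  (forall c w, f (c *: w) = s c%:P *: f w) -> (forall w, f (phi w) = s 'X *: f w) ->
  forall p (w : pW), f (p *: w) = s p *: f w.
Proof.
move=> fZ fphi p w; elim/poly_ind: p => [|p c IH].
  by rewrite scale0r rmorph0 scale0r raddf0.
rewrite scalerDl raddfD commr_polyX -scalerA poly_moduleX poly_moduleC fphi fZ IH.
by rewrite rmorphD rmorphM scalerDl scalerA.
Qed.

End PolynomialModuleOfEndomorphism.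

Section QuotientModule.
Variables (R : nzRingType) (M : lmodType R) (S : zmodClosed M).
Hypothesis S_scale : GRing.scaler_closed S.

Definition module_quot of GRing.scaler_closed S := Quotient.quot S.
Local Notation Q := (module_quot S_scale).

HB.instance Definition _ := GRing.Zmodule.on Q.

Definition quot_class (v : M) : Q := \pi_(Quotient.quot S) v.

Lemma quot_class_eq v w : quot_class v = quot_class w <-> v - w \in S.
Proof.
by rewrite Quotient.idealrBE; split=> [vw | /eqP //]; apply/eqP.
Qed.

Lemma quot_class_repr (x : Q) : quot_class (repr x) = x.
Proof. exact: reprK. Qed.

Let scale a (x : Q) : Q := quot_class (a *: repr x).

Let scale_class a v : scale a (quot_class v) = quot_class (a *: v).
Proof.
apply/quot_class_eq; rewrite -scalerBr; apply: S_scale.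
exact/quot_class_eq/quot_class_repr.
Qed.

Let quot_classB : zmod_morphism quot_class.
Proof. by move=> v w; exact: raddfB. Qed.

HB.instance Definition _ := GRing.isZmodMorphism.Build M Q quot_class quot_classB.

Let scaleA a b x : scale a (scale b x) = scale (a * b) x.
Proof. by rewrite -[x]quot_class_repr !scale_class scalerA. Qed.

Let scale1 : left_id 1 scale.
Proof. by move=> x; rewrite -[x]quot_class_repr scale_class scale1r. Qed.

Let scaleDr : right_distributive scale +%R.
Proof.
move=> a x y; rewrite -[x]quot_class_repr -[y]quot_class_repr -raddfD.
by rewrite !scale_class scalerDr raddfD.
Qed.

Let scaleDl x : {morph scale^~ x : a b / a + b}.
Proof.
by move=> a b; rewrite -[x]quot_class_repr !scale_class scalerDl raddfD.
Qed.

HB.instance Definition _ :=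
  GRing.Zmodule_isLmodule.Build R Q scaleA scale1 scaleDr scaleDl.

Let quot_classZ : scalable quot_class.
Proof. by move=> a v; rewrite -scale_class. Qed.

HB.instance Definition _ := GRing.isScalable.Build R M Q *:%R quot_class quot_classZ.

Lemma quot_class_eq0 v : quot_class v = 0 <-> v \in S.
Proof. by rewrite -[0](raddf0 quot_class) quot_class_eq subr0. Qed.

End QuotientModule.

Section FreeModule.
Variables (R : nzRingType) (T : choiceType).
Local Notation freeRT := {freeg T / R}.

Lemma freegZU (a : R) (x : T) : << a *g x >> = a *: << x >> :> freeRT.
Proof. by apply/eqP/freeg_eqP => y; rewrite coeffZ !coeffU mulrA mulr1. Qed.

Lemma freeg_cons (a : R) (x : T) s : [freeg (a, x) :: s] = a *: << x >> + [freeg s].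
Proof. by rewrite -cat1s freeg_cat freegZU. Qed.

Lemma freeg_sum (s : seq (R * T)) : [freeg s] = \sum_(p <- s) p.1 *: << p.2 >>.
Proof.
elim: s => [|[a x] s IH]; first by rewrite big_nil freeg_nil.
by rewrite freeg_cons IH big_cons.
Qed.

Lemma freeg_flatten (ss : seq (seq (R * T))) :
  [freeg flatten ss] = \sum_(s <- ss) [freeg s].
Proof.
by elim: ss => [|s ss IH]; rewrite ?big_nil ?freeg_nil // big_cons freeg_cat IH.
Qed.

Lemma precoeff_freegP (s s' : seq (R * T)) :
  (forall x, precoeff x s = precoeff x s') <-> [freeg s] = [freeg s'].
Proof.
split=> [ss' | ss' x]; last by rewrite -!coeff_Freeg ss'.
by apply/eqP/freeg_eqP => x; rewrite !coeff_Freeg.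
Qed.

Lemma freeg_linear_eq (N : lmodType R) (f f' : {linear freeRT -> N}) :
  (forall x, f << x >> = f' << x >>) -> f =1 f'.
Proof.
move=> ff' x; rewrite -[x]Freeg_enum freeg_sum !linear_sum.
by apply: eq_bigr => p _; rewrite !linearZ /= ff'.
Qed.

Variables (M : lmodType R) (f : T -> M).

HB.instance Definition _ :=
  GRing.isZmodMorphism.Build freeRT M (fglift f) (lift_is_additive f).

Let fglift_scalable : scalable (fglift f).
Proof.
move=> a x; rewrite -[x]Freeg_enum freeg_sum scaler_sumr.
rewrite [LHS]raddf_sum [in RHS]raddf_sum scaler_sumr.
by apply: eq_bigr => p _; rewrite /= scalerA -!freegZU !liftU scalerA.
Qed.

HB.instance Definition _ :=
  GRing.isScalable.Build R freeRT M *:%R (fglift f) fglift_scalable.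

Lemma fgliftU1 x : fglift f << x >> = f x.
Proof. by rewrite liftU scale1r. Qed.

End FreeModule.

Section Words.
Variable V : Type.
Implicit Types (g u w : word V) (m : V -> int).

Lemma winv_cat u w : winv (u ++ w) = winv w ++ winv u.
Proof. by rewrite /winv map_cat rev_cat. Qed.

Lemma winvK : involutive (@winv V).
Proof.
move=> u; rewrite /winv map_rev revK -map_comp -[RHS]map_id.
by apply: eq_map => -[v b] /=; rewrite negbK.
Qed.

Lemma wpowS g n : wpow g n.+1 = g ++ wpow g n.
Proof. by []. Qed.

Definition wpowz g (k : int) : word V :=
  match k with Posz n => wpow g n | Negz n => wpow (winv g) n.+1 end.

Lemma wpowzN g n : wpowz g (- n%:Z) = wpow (winv g) n.
Proof. by case: n. Qed.

Definition wconj g u : word V := g ++ u ++ winv g.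

Lemma wconj_cat g h u : wconj (g ++ h) u = wconj g (wconj h u).
Proof. by rewrite /wconj winv_cat !catA. Qed.

Lemma chi_nil m : chi m [::] = 0.
Proof. exact: big_nil. Qed.

Lemma chi1 m v b : chi m [:: (v, b)] = if b then - m v else m v.
Proof. exact: big_seq1. Qed.

Lemma chi_cat m u w : chi m (u ++ w) = chi m u + chi m w.
Proof. exact: big_cat. Qed.

Lemma chi_cons m l u : chi m (l :: u) = chi m [:: l] + chi m u.
Proof. by rewrite -cat1s chi_cat. Qed.

Lemma chi_winv m u : chi m (winv u) = - chi m u.
Proof.
elim: u => [|[v b] u IH]; first by rewrite chi_nil oppr0.
by rewrite -cat1s winv_cat !chi_cat IH opprD addrC !chi1; case: b; rewrite ?opprK.
Qed.

Lemma chi_wpow m u n : chi m (wpow u n) = chi m u *+ n.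
Proof.
elim: n => [|n IH]; first exact: chi_nil.
by rewrite wpowS chi_cat IH mulrS.
Qed.

Lemma chi_wpowz m u k : chi m (wpowz u k) = chi m u * k.
Proof.
by case: k => n; rewrite chi_wpow ?chi_winv ?mulNrn ?NegzE ?mulrN pmulrn mulrzz.
Qed.

Lemma chi_wconj m g u : chi m (wconj g u) = chi m u.
Proof. by rewrite !chi_cat chi_winv addrC subrK. Qed.

Lemma chi_artin_rel m (a b : V) n : chi m (artin_rel a b n) = chi m (artin_rel b a n).
Proof. by rewrite !chi_wpow !(chi_cons m (_, _) [:: _]) addrC. Qed.

Variables (adj : rel V) (lt : V -> V -> nat).
Local Notation "u ~ w" := (aeq adj lt u w) (at level 70).

Lemma chi_aeq m u w : u ~ w -> chi m u = chi m w.
Proof.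
elim=> {u w} [//|//|u w x _ -> _ -> //|a b u w _ uw|v b|v w _].
- by rewrite !chi_cat uw.
- by rewrite chi_cons !chi1 chi_nil; case: b; rewrite /= ?subrr ?addNr.
- exact: chi_artin_rel.
Qed.

Lemma aeq_cat u u' w w' : u ~ u' -> w ~ w' -> u ++ w ~ u' ++ w'.
Proof.
move=> uu' ww'; apply: (@aeq_trans _ _ _ _ (u' ++ w)).
  exact: (aeq_ctx [::] w uu').
by have := aeq_ctx u' [::] ww'; rewrite !cats0.
Qed.

Lemma aeq_catl u w w' : w ~ w' -> u ++ w ~ u ++ w'.
Proof. by apply: aeq_cat; apply: aeq_refl. Qed.

Lemma aeq_catr u u' w : u ~ u' -> u ++ w ~ u' ++ w.
Proof. by move/aeq_cat; apply; apply: aeq_refl. Qed.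

Lemma aeq_mulwV u : u ++ winv u ~ [::].
Proof.
elim: u => [|[v b] u IH]; first exact: aeq_refl.
rewrite -cat1s winv_cat -catA (catA u).
apply: aeq_trans (aeq_free _ _ v b).
exact: (aeq_catl [:: (v, b)] (aeq_catr _ IH)).
Qed.

Lemma aeq_mulVw u : winv u ++ u ~ [::].
Proof. by have := aeq_mulwV (winv u); rewrite winvK. Qed.

Lemma aeq_wconj_cat g u w : wconj g u ++ wconj g w ~ wconj g (u ++ w).
Proof.
rewrite /wconj -!catA; do 2 apply: aeq_catl.
by rewrite catA; apply: (aeq_catr _ (aeq_mulVw _)).
Qed.

Lemma aeq_winv u w : u ~ w -> winv u ~ winv w.
Proof.
move=> uw; apply: (@aeq_trans _ _ _ _ (winv u ++ w ++ winv w)).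
  rewrite -[X in X ~ _]cats0; exact/aeq_catl/aeq_sym/aeq_mulwV.
apply: (@aeq_trans _ _ _ _ (winv u ++ u ++ winv w)).
  exact/aeq_catl/aeq_catr/aeq_sym.
by rewrite catA; apply: (aeq_catr _ (aeq_mulVw u)).
Qed.

Lemma aeq_wconj g h u w : g ~ h -> u ~ w -> wconj g u ~ wconj h w.
Proof. by move=> gh uw; do 2 apply: aeq_cat => //; apply: aeq_winv. Qed.

Lemma aeq_wpowz_succ g k : g ++ wpowz g k ~ wpowz g (k + 1).
Proof.
case: k => [n|n]; first by rewrite -PoszD addn1; apply: aeq_refl.
rewrite /wpowz wpowS catA NegzE -addn1 PoszD opprD subrK.
case: n => [|n]; rewrite -?NegzE /=; exact: (aeq_catr _ (aeq_mulwV g)).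
Qed.

Lemma aeq_wpowz_pred g k : winv g ++ wpowz g k ~ wpowz g (k - 1).
Proof.
case: k => [[|n]|n]; first exact: aeq_refl.
  by rewrite -addn1 PoszD addrK /= addn1 wpowS catA; apply: (aeq_catr _ (aeq_mulVw g)).
by rewrite NegzE -opprD -PoszD addn1 -NegzE; apply: aeq_refl.
Qed.

Lemma aeq_wpowzD g a b : wpowz g a ++ wpowz g b ~ wpowz g (a + b).
Proof.
elim: a => [|n IH|n IH]; first by rewrite add0r; apply: aeq_refl.
- rewrite [in X in _ ~ wpowz g X]intS [1 + _]addrC addrAC /wpowz wpowS -catA.
  apply: aeq_trans (aeq_wpowz_succ _ _); exact: aeq_catl.
- rewrite -NegzE /wpowz wpowS -catA NegzE -addn1 PoszD opprD addrAC.
  apply: aeq_trans (aeq_wpowz_pred _ _); apply: aeq_catl.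
  by apply: aeq_trans IH; case: n => [|n]; apply: aeq_refl.
Qed.

Lemma aeq_wpow_winv g n : wpow g n ++ wpow (winv g) n ~ [::].
Proof. by have := aeq_wpowzD g n%:Z (- n%:Z); rewrite subrr wpowzN. Qed.

End Words.

Section HomologyModule.
Variables (V : choiceType) (adj : rel V) (lt : V -> V -> nat) (m : V -> int).
Variable K : fieldType.
Local Notation chain := (chain V K).
Local Notation is_chain := (@is_chain V m K).
Local Notation "u ~ w" := (aeq adj lt u w) (at level 70).
Local Notation KW := {freeg (word V) / K}.
Implicit Types (c : chain) (u w h : word V) (x y : KW).

Definition conj_map h : KW -> KW := fglift (fun u => << wconj h u >>).
HB.instance Definition _ h := GRing.Linear.on (conj_map h).

Lemma conj_mapU h u : conj_map h << u >> = << wconj h u >>.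
Proof. exact: fgliftU1. Qed.

Lemma conj_map_cat h k : conj_map (h ++ k) =1 conj_map h \o conj_map k.
Proof. by apply: freeg_linear_eq => u /=; rewrite !conj_mapU wconj_cat. Qed.

Lemma conj_map_wpow h n : conj_map (wpow h n) =1 iter n (conj_map h).
Proof.
elim: n => [|n IH] x; last by rewrite wpowS conj_map_cat /= IH.
move: x; apply: (@freeg_linear_eq _ _ _ (conj_map [::]) idfun) => u.
by rewrite /= conj_mapU /wconj /= cats0.
Qed.

Lemma freeg_scalec a c : [freeg scalec a c] = a *: [freeg c].
Proof.
rewrite !freeg_sum big_map scaler_sumr.
by apply: eq_bigr => p _; rewrite scalerA.
Qed.

Lemma freeg_conjc h n c : [freeg conjc h n c] = conj_map (wpow h n) [freeg c].
Proof.
rewrite !freeg_sum big_map linear_sum.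
by apply: eq_bigr => p _; rewrite linearZ /= conj_mapU.
Qed.

Definition h1_relation x : Prop := exists2 r, h1rel adj lt m r & x = [freeg r].

Lemma h1zero_relation c : h1zero adj lt m c <-> h1_relation [freeg c].
Proof.
split=> [[r [rr cr]] | [r rr /precoeff_freegP cr]]; last by exists r.
by exists r => //; apply/precoeff_freegP.
Qed.

Lemma h1_relation0 : h1_relation 0.
Proof. by exists [::]; [exact: h1rel_nil | rewrite freeg_nil]. Qed.

Lemma h1_relationD x y : h1_relation x -> h1_relation y -> h1_relation (x + y).
Proof.
move=> [r rr ->] [s ss ->]; exists (r ++ s); first exact: h1rel_cat.
by rewrite freeg_cat.
Qed.

Lemma h1_relationZ a x : h1_relation x -> h1_relation (a *: x).
Proof.
move=> [r rr ->]; exists (scalec a r); last by rewrite freeg_scalec.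
elim: rr => [|b u w u0 w0|b u w u0 uw|r1 r2 _ IH1 _ IH2] /=.
- exact: h1rel_nil.
- by rewrite mulrN; apply: h1rel_mul.
- by rewrite mulrN; apply: h1rel_eq.
- by rewrite /scalec map_cat; apply: h1rel_cat.
Qed.

Lemma h1_relation_mul u w : chi m u = 0 -> chi m w = 0 ->
  h1_relation (<< u >> + << w >> - << u ++ w >>).
Proof.
move=> u0 w0; exists [:: (1, u); (1, w); (- 1, u ++ w)]; first exact: h1rel_mul.
by rewrite [RHS]freeg_sum !big_cons big_nil addr0 scaleN1r !scale1r addrA.
Qed.

Lemma h1_relation_aeq u w : chi m u = 0 -> u ~ w ->
  h1_relation (<< u >> - << w >>).
Proof.
move=> u0 uw; exists [:: (1, u); (- 1, w)]; first exact: h1rel_eq.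
by rewrite [RHS]freeg_sum !big_cons big_nil addr0 scaleN1r !scale1r.
Qed.

Lemma h1_relation_ind (P : KW -> Prop) :
  P 0 -> (forall x y, P x -> P y -> P (x + y)) -> (forall a x, P x -> P (a *: x)) ->
  (forall u w, chi m u = 0 -> chi m w = 0 -> P (<< u >> + << w >> - << u ++ w >>)) ->
  (forall u w, chi m u = 0 -> u ~ w -> P (<< u >> - << w >>)) ->
  forall x, h1_relation x -> P x.
Proof.
move=> P0 PD PZ Pmul Paeq x [r rr ->].
elim: rr => [|a u w u0 w0|a u w u0 uw|r1 r2 _ IH1 _ IH2].
- by rewrite freeg_nil.
- rewrite freeg_sum !big_cons big_nil addr0 scaleNr addrA -scalerDr -scalerBr.
  exact/PZ/Pmul.
- rewrite freeg_sum !big_cons big_nil addr0 scaleNr -scalerBr.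
  exact/PZ/Paeq.
- by rewrite freeg_cat; apply: PD.
Qed.

Lemma h1_relation_conj h x : h1_relation x -> h1_relation (conj_map h x).
Proof.
elim/h1_relation_ind: x / => [|x y|a x|u w u0 w0|u w u0 uw].
- by rewrite linear0; apply: h1_relation0.
- by rewrite linearD; apply: h1_relationD.
- by rewrite linearZ; apply: h1_relationZ.
- rewrite linearB linearD /= !conj_mapU -(subrKA << wconj h u ++ wconj h w >>).
  apply: h1_relationD.
    by apply: h1_relation_mul; rewrite chi_wconj.
  apply: h1_relation_aeq; last exact: aeq_wconj_cat.
  by rewrite chi_cat !chi_wconj u0 w0.
- rewrite linearB /= !conj_mapU; apply: h1_relation_aeq; rewrite ?chi_wconj //.
  by apply: aeq_wconj => //; apply: aeq_refl.
Qed.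

(* Dropping the words outside the kernel of [chi] gives every chain, and not
   only those on the kernel, a class in [H1]. *)
Definition kernel_part : KW -> KW :=
  fglift (fun u => if chi m u == 0 then << u >> else 0).
HB.instance Definition _ := GRing.Linear.on kernel_part.

Lemma kernel_partU u : kernel_part << u >> = if chi m u == 0 then << u >> else 0.
Proof. exact: fgliftU1. Qed.

Lemma kernel_part_conj h x : kernel_part (conj_map h x) = conj_map h (kernel_part x).
Proof.
apply: (@freeg_linear_eq _ _ _ (kernel_part \o conj_map h)
  (conj_map h \o kernel_part)) => u /=.
rewrite conj_mapU !kernel_partU chi_wconj.
by case: ifP; rewrite ?linear0 // conj_mapU.
Qed.

Lemma kernel_part_filter c :
  kernel_part [freeg c] = [freeg [seq p <- c | chi m p.2 == 0]].
Proof.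
elim: c => [|[a u] c IH] /=; first by rewrite freeg_nil linear0.
rewrite freeg_cons linearD linearZ /= kernel_partU IH.
case: ifP => _; first by rewrite [RHS]freeg_cons.
by rewrite scaler0 add0r.
Qed.

Lemma kernel_part_chain c : is_chain c -> kernel_part [freeg c] = [freeg c].
Proof. by rewrite kernel_part_filter => /all_filterP ->. Qed.

Definition h1_null : {pred KW} := fun x => `[< h1_relation (kernel_part x) >].

Lemma h1_nullP x : reflect (h1_relation (kernel_part x)) (x \in h1_null).
Proof. exact: asboolP. Qed.

Lemma h1_null_submod_closed : submod_closed h1_null.
Proof.
split=> [|a x y /h1_nullP x0 /h1_nullP y0]; apply/h1_nullP.
  by rewrite linear0; apply: h1_relation0.
by rewrite linearP; apply: h1_relationD => //; apply: h1_relationZ.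
Qed.

HB.instance Definition _ := GRing.isSubmodClosed.Build K KW h1_null
  h1_null_submod_closed.

Lemma h1_null_conj h x : x \in h1_null -> conj_map h x \in h1_null.
Proof.
move/h1_nullP/h1_relation_conj => x0; apply/h1_nullP.
by rewrite kernel_part_conj.
Qed.

Lemma h1_null_aeq u w : u ~ w -> << u >> - << w >> \in h1_null.
Proof.
move=> uw; apply/h1_nullP; rewrite linearB /= !kernel_partU -(chi_aeq m uw).
case: eqP => u0; first exact: h1_relation_aeq.
by rewrite subrr; apply: h1_relation0.
Qed.

Lemma h1_null_conj1 h x : h ~ [::] -> conj_map h x - x \in h1_null.
Proof.
move=> h1; rewrite -[x]Freeg_enum freeg_sum linear_sum -sumrB rpred_sum // => p _.
rewrite linearZ -scalerBr rpredZ //= conj_mapU; apply: h1_null_aeq.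
rewrite -[X in _ ~ X]cats0; apply: aeq_wconj h1 (aeq_refl _ _ _).
Qed.

Variable g : word V.
Local Notation word_module := (poly_module (conj_map g)).

Lemma h1_null_scale : GRing.scaler_closed (h1_null : {pred word_module}).
Proof.
move=> p x; apply: scaler_closed_poly_module => {x} [a x|x].
  exact: rpredZ.
exact: h1_null_conj.
Qed.

HB.instance Definition _ := GRing.ZmodClosed.on (h1_null : {pred word_module}).

Definition H1 := module_quot h1_null_scale.
HB.instance Definition _ := GRing.Lmodule.on H1.

Definition h1_class : {linear word_module -> H1} := quot_class h1_null_scale.

Lemma h1_class_eq0 x : h1_class x = 0 <-> x \in h1_null.
Proof. exact: quot_class_eq0. Qed.

Definition word_class u : H1 := h1_class << u >>.
Definition chain_class c : H1 := h1_class [freeg c].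

Lemma chain_class_sum c : chain_class c = \sum_(p <- c) p.1%:P *: word_class p.2.
Proof.
rewrite /chain_class freeg_sum -[\sum_(p <- c) _]/(\sum_(p <- c) _ : word_module).
rewrite linear_sum; apply: eq_bigr => p _.
by rewrite -linearZ poly_moduleC.
Qed.

Lemma word_class_aeq u w : u ~ w -> word_class u = word_class w.
Proof. by move=> uw; apply/quot_class_eq/h1_null_aeq. Qed.

Lemma word_class_cat u w : chi m u = 0 -> chi m w = 0 ->
  word_class (u ++ w) = word_class u + word_class w.
Proof.
move=> u0 w0; apply/esym/eqP; rewrite -subr_eq0 -raddfD -raddfB; apply/eqP.
apply/h1_class_eq0/h1_nullP; rewrite linearB linearD /= !kernel_partU.
by rewrite chi_cat u0 w0 addr0 eqxx; apply: h1_relation_mul.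
Qed.

Lemma word_class_nil : word_class [::] = 0.
Proof.
apply: (addrI (word_class [::])); rewrite addr0.
by rewrite -[LHS]word_class_cat ?chi_nil.
Qed.

Lemma word_class_conj u : word_class (wconj g u) = 'X *: word_class u.
Proof. by rewrite -linearZ poly_moduleX /= conj_mapU. Qed.

Lemma chain_class_eq0 c :
  is_chain c -> chain_class c = 0 <-> h1zero adj lt m c.
Proof.
move=> c_chain; rewrite h1_class_eq0 h1zero_relation.
by rewrite -{2}(kernel_part_chain c_chain); split=> /h1_nullP.
Qed.

Lemma chain_class_surj (y : H1) : exists2 c, is_chain c & chain_class c = y.
Proof.
pose x : KW := repr y; pose c := [seq p <- fgenum x | chi m p.2 == 0].
have c_chain : is_chain c by apply: filter_all.
exists c => //; rewrite -[y]quot_class_repr.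
apply/quot_class_eq/h1_nullP; rewrite linearB /= kernel_part_chain //.
by rewrite -kernel_part_filter Freeg_enum subrr; apply: h1_relation0.
Qed.

Lemma chain_class_lact n p c :
  'X^n *: chain_class (lact g (n, p) c) = p *: chain_class c.
Proof.
pose x : word_module := conj_map (wpow (winv g) n) [freeg c].
have -> : chain_class (lact g (n, p) c) = p *: h1_class x.
  rewrite /chain_class -linearZ poly_moduleE freeg_flatten big_map.
  congr (h1_class _); rewrite -[RHS](big_mkord xpredT
    (fun i => p`_i *: (iter i (conj_map g) x : KW))) /index_iota subn0.
  by apply: eq_bigr => i _; rewrite freeg_scalec !freeg_conjc conj_map_wpow.
rewrite scalerA mulrC -scalerA; congr (_ *: _).
rewrite -[LHS]linearZ poly_moduleXn.
apply/quot_class_eq; rewrite -conj_map_wpow -[conj_map _ x]conj_map_cat.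
exact/h1_null_conj1/aeq_wpow_winv.
Qed.

Lemma is_chain_flatten (cs : seq chain) :
  all is_chain cs -> is_chain (flatten cs).
Proof.
elim: cs => //= c cs IH /andP[c_chain /IH cs_chain].
by rewrite /Defs.is_chain all_cat; apply/andP.
Qed.

Lemma is_chain_lact l c : is_chain c -> is_chain (lact g l c).
Proof.
move=> c_chain; apply: is_chain_flatten; rewrite all_map; apply/allP => i _ /=.
rewrite /Defs.is_chain !all_map; apply: sub_all c_chain => p /=.
by rewrite -/(wconj _ (wconj _ _)) !chi_wconj.
Qed.

Lemma chain_class_flatten (cs : seq chain) :
  chain_class (flatten cs) = \sum_(c <- cs) chain_class c.
Proof.
elim: cs => [|c cs IH]; first by rewrite big_nil /chain_class freeg_nil linear0.
by rewrite big_cons -IH /chain_class freeg_cat linearD.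
Qed.

Definition laurent_comb (ls : seq (laurent K)) (cs : seq chain) : chain :=
  flatten [seq lact g lc.1 lc.2 | lc <- zip ls cs].

Lemma is_chain_laurent_comb ls cs :
  all is_chain cs -> is_chain (laurent_comb ls cs).
Proof.
move=> cs_chain; apply: is_chain_flatten; rewrite all_map.
apply/allP => lc /(map_f snd); rewrite -/(unzip2 _) => lc_cs.
apply: is_chain_lact; apply: (allP cs_chain).
elim: cs ls lc_cs {cs_chain} => [|c cs IH] [|l ls] //=.
by rewrite !inE => /orP[-> // | /IH ->]; rewrite orbT.
Qed.

Lemma scaleXn_laurent_comb ls cs : size ls = size cs ->
  let n := (\sum_(l <- ls) l.1)%N in
  'X^n *: chain_class (laurent_comb ls cs) =
  \sum_(i < size cs) ('X^(n - (nth (0%N, 0) ls i).1) * (nth (0%N, 0) ls i).2) *: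
    chain_class (nth [::] cs i).
Proof.
move=> size_ls n; rewrite chain_class_flatten big_map (big_nth ((0%N, 0), [::])).
rewrite big_mkord size_zip size_ls minnn scaler_sumr; apply: eq_bigr => i _.
rewrite nth_zip //=; set l := nth _ ls i.
have le_ln : (l.1 <= n)%N.
  rewrite /n (big_nth (0%N, 0)) (bigD1_seq (i : nat)) ?iota_uniq //= ?leq_addr //.
  by rewrite mem_iota size_ls /= subn0.
rewrite -{1}(subnK le_ln) exprD -scalerA [l]surjective_pairing chain_class_lact.
by rewrite scalerA.
Qed.

Lemma h1_independentP cs : h1_independent adj lt m g cs <->
  all is_chain cs /\
  free_family (fun i : 'I_(size cs) => chain_class (nth [::] cs i)).
Proof.
split=> -[cs_chain indep]; split=> //.
- move=> a a0 i; pose ls := [seq (0%N, a i) | i <- enum 'I_(size cs)].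
  have size_ls : size ls = size cs by rewrite size_map size_enum_ord.
  have lsE (j : 'I_(size cs)) : nth (0%N, 0) ls j = (0%N, a j).
    by rewrite (nth_map j) ?size_enum_ord // nth_ord_enum.
  have /allP ls0 : all (fun l => l.2 == 0) ls.
    apply: indep => //; apply/chain_class_eq0.
      exact: is_chain_laurent_comb.
    have := scaleXn_laurent_comb size_ls; rewrite /= big_map big1 // scale1r => ->.
    rewrite -[RHS]a0; apply: eq_bigr => j _.
    by rewrite lsE subn0 mul1r.
  by apply/eqP/(ls0 (0%N, a i))/map_f; rewrite mem_enum.
- move=> ls size_ls /chain_class_eq0 => /(_ (is_chain_laurent_comb _ cs_chain)) ls0.
  have := scaleXn_laurent_comb size_ls; rewrite /= ls0 scaler0 => /esym/indep free0.
  apply/(all_nthP (0%N, 0)) => i; rewrite size_ls => i_lt.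
  have /eqP := free0 (Ordinal i_lt); rewrite mulf_eq0 expf_eq0 polyX_eq0 andbF.
  by [].
Qed.

Lemma h1_independent_lift n (y : 'I_n -> H1) : free_family y ->
  exists2 cs : seq chain, h1_independent adj lt m g cs & size cs = n.
Proof.
move=> y_free; have [c c_chain cy] := fin_all_exists2 (fun i => chain_class_surj (y i)).
pose cs := [seq c i | i <- enum 'I_n].
have size_cs : size cs = n by rewrite size_map size_enum_ord.
exists cs => //; apply/h1_independentP; split.
  by rewrite all_map; apply/allP => i _ /=; apply: c_chain.
rewrite (_ : (fun i => _) = y \o cast_ord size_cs); first exact: free_family_cast.
apply/funext => i /=; pose j := cast_ord size_cs i; rewrite -[i : nat]/(j : nat).
by rewrite (nth_map j) ?size_enum_ord // nth_ord_enum cy.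
Qed.

Lemma h1_rank_isP r : h1_rank_is adj lt m K g r <-> module_rank_is H1 r.
Proof.
split=> -[].
- move=> [cs [/h1_independentP[_ cs_free] <-]] rank_max.
  split; first by exists (fun i : 'I_(size cs) => chain_class (nth [::] cs i)).
  by move=> n y /h1_independent_lift[ds /rank_max + <-].
- move=> [y /h1_independent_lift[cs cs_indep size_cs]] rank_max.
  split; first by exists cs.
  by move=> ds /h1_independentP[_ /rank_max].
Qed.

Lemma h1_torsionP : h1_torsion adj lt m K g <-> torsion_module H1.
Proof.
split=> tors.
- move=> y; have [c c_chain <-] := chain_class_surj y.
  have [[n p] [p0 /chain_class_eq0]] := tors c c_chain.
  move/(_ (is_chain_lact _ c_chain)) => lc0; exists p => //.
  by rewrite -(chain_class_lact n) lc0 scaler0.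
- move=> c c_chain; have [p p0 pc0] := tors (chain_class c); exists (0%N, p).
  split=> //; apply/chain_class_eq0; first exact: is_chain_lact.
  by have := chain_class_lact 0 p c; rewrite pc0 expr0 scale1r.
Qed.

End HomologyModule.

Section FoxCalculus.
Variables (V : finType) (m : V -> int) (L : fieldType) (t : L).
Hypothesis t_neq0 : t != 0.
Local Notation deg := (chi m).
Implicit Types (u h : word V) (v w : V).

Definition fox_gen v : 'rV[L]_#|V| := delta_mx 0 (enum_rank v).

Definition fox_letter (l : V * bool) : 'rV[L]_#|V| :=
  if l.2 then - t ^ (- m l.1) *: fox_gen l.1 else fox_gen l.1.

(* The row of Fox derivatives of a word, with [g_v] evaluated at [t ^ m v]. *)
Definition fox u : 'rV[L]_#|V| :=
  foldr (fun l q => fox_letter l + t ^ deg [:: l] *: q) 0 u.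

Lemma fox_cat u u' : fox (u ++ u') = fox u + t ^ deg u *: fox u'.
Proof.
elim: u => [|l u IH]; first by rewrite chi_nil expr0z scale1r add0r.
rewrite [fox (_ ++ _)]/= -/(fox _) IH scalerDr addrA scalerA -expfzDr //.
by rewrite -chi_cons.
Qed.

Lemma fox1 l : fox [:: l] = fox_letter l.
Proof. by rewrite /= scaler0 addr0. Qed.

Lemma fox_free v b : fox [:: (v, b); (v, ~~ b)] = 0.
Proof.
rewrite /= scaler0 addr0 chi1 /fox_letter; case: b => /=.
  by rewrite scaleNr addNr.
by rewrite scalerA mulrN -expfzDr // subrr expr0z scaleN1r subrr.
Qed.

Lemma fox_mulwV u : fox (u ++ winv u) = 0.
Proof.
elim: u => [//|[v b] u IH].
rewrite -cat1s winv_cat -catA (catA u) 2!fox_cat IH add0r.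
rewrite chi_cat chi_winv subrr expr0z scale1r -fox_cat.
exact: fox_free.
Qed.

Lemma fox_winv u : fox (winv u) = - t ^ (- deg u) *: fox u.
Proof.
have /eqP := fox_mulwV u; rewrite fox_cat addrC addr_eq0 => /eqP uV.
by rewrite scaleNr -scalerN -uV scalerA -expfzDr // addNr expr0z scale1r.
Qed.

Lemma fox_wconj h u : deg u = 0 -> fox (wconj h u) = t ^ deg h *: fox u.
Proof.
move=> u0; rewrite !fox_cat u0 expr0z scale1r fox_winv scalerDr scalerA mulrN.
by rewrite -expfzDr // subrr expr0z scaleN1r addrCA subrr addr0.
Qed.

Lemma fox_wpow_sub h n : (fox (wpow h n) <= fox h)%MS.
Proof.
elim: n => [|n IH]; first exact: sub0mx.
by rewrite wpowS fox_cat addmx_sub ?scalemx_sub.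
Qed.

Lemma fox_winv_sub h : (fox (winv h) <= fox h)%MS.
Proof. by rewrite fox_winv scalemx_sub. Qed.

Lemma fox_wpowz_sub h k : (fox (wpowz h k) <= fox h)%MS.
Proof.
case: k => n; first exact: fox_wpow_sub.
exact: submx_trans (fox_wpow_sub _ _) (fox_winv_sub h).
Qed.

Definition augmentation_col : 'cV[L]_#|V| := \col_i (1 - t ^ m (enum_val i)).

Lemma fox_fundamental_formula u : fox u *m augmentation_col = (1 - t ^ deg u)%:M.
Proof.
have gen v : fox_gen v *m augmentation_col = (1 - t ^ m v)%:M.
  by apply/rowP => i; rewrite -rowE !mxE enum_rankK ord1.
have letter l : fox_letter l *m augmentation_col = (1 - t ^ deg [:: l])%:M.
  case: l => v b; rewrite chi1 /fox_letter; case: b => /=; last exact: gen.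
  rewrite -scalemxAl gen scale_scalar_mx mulNr mulrBr mulr1 -expfzDr // addNr.
  by rewrite opprB.
elim: u => [|l u IH]; first by rewrite chi_nil expr0z subrr mul0mx raddf0.
rewrite -cat1s fox_cat chi_cat mulmxDl -scalemxAl IH fox1 letter scale_scalar_mx.
by rewrite -raddfD /= expfzDr // mulrBr mulr1 addrA subrK.
Qed.

Definition artin_factor v w n : L := \sum_(i < n) (t ^ (m v + m w)) ^+ i.

Lemma fox_artin v w n : fox (artin_rel v w n) =
  artin_factor v w n *: (fox_gen v + t ^ m v *: fox_gen w).
Proof.
have deg_vw : deg [:: (v, false); (w, false)] = m v + m w.
  by rewrite chi_cons !chi1.
have fox_vw : fox [:: (v, false); (w, false)] = fox_gen v + t ^ m v *: fox_gen w.
  by rewrite /= scaler0 addr0 chi1.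
rewrite /artin_factor /artin_rel; elim: n => [|n IH].
  by rewrite big_ord0 scale0r.
rewrite wpowS fox_cat IH big_ord_recl expr0 scalerDl scale1r scalerA deg_vw fox_vw.
congr (_ + _ *: _); rewrite mulr_sumr.
by apply: eq_bigr => i _; rewrite exprS.
Qed.

Definition artin_relator v w n : 'rV[L]_#|V| :=
  fox (artin_rel v w n) - fox (artin_rel w v n).

Lemma artin_relatorE v w n : artin_relator v w n =
  artin_factor v w n *:
    ((1 - t ^ m w) *: fox_gen v - (1 - t ^ m v) *: fox_gen w).
Proof.
rewrite /artin_relator !fox_artin {2}/artin_factor [m w + _]addrC.
rewrite -/(artin_factor v w n) -scalerBr; congr (_ *: _).
rewrite !scalerBl !scale1r !opprD opprK.
by rewrite [- _ - _]addrC addrACA [_ *: _ - _]addrC.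
Qed.

Lemma artin_relator_augmentation v w n : artin_relator v w n *m augmentation_col = 0.
Proof. by rewrite mulmxBl !fox_fundamental_formula chi_artin_rel subrr. Qed.

Lemma artin_factor_eq0 v w n : (forall k : int, t ^ k = 1 -> k = 0) -> (0 < n)%N ->
  (artin_factor v w n == 0) = (m v + m w == 0) && (n%:R == 0 :> L).
Proof.
move=> t_inf n_gt0; rewrite /artin_factor; have [-> | k0] /= := eqVneq (m v + m w) 0.
  under eq_bigr => i _ do rewrite expr0z expr1n.
  by rewrite sumr_const card_ord.
apply: contraNF k0 => /eqP s0.
have /eqP : (t ^ (m v + m w)) ^+ n - 1 = 0 by rewrite subrX1 s0 mulr0.
rewrite subr_eq0 exprnP exprz_exp => /eqP/t_inf/eqP.
by rewrite mulf_eq0 => /orP[// | /eqP[n0]]; rewrite n0 in n_gt0.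
Qed.

Variables (adj : rel V) (lt : V -> V -> nat).

Definition edge_space : 'M[L]_#|V| :=
  (\sum_(e : V * V | adj e.1 e.2) <<artin_relator e.1 e.2 (lt e.1 e.2)>>)%MS.

Lemma artin_relator_sub v w :
  adj v w -> (artin_relator v w (lt v w) <= edge_space)%MS.
Proof. by move=> vw; apply: (@sumsmx_sup _ _ (v, w)) => //; rewrite genmxE. Qed.

Lemma edge_space_sub k (B : 'M_(k, #|V|)) :
  (forall v w, adj v w -> (artin_relator v w (lt v w) <= B)%MS) ->
  (edge_space <= B)%MS.
Proof. by move=> vwB; apply/sumsmx_subP => -[v w] /= /vwB; rewrite genmxE. Qed.

Lemma edge_space_augmentation : edge_space *m augmentation_col = 0.
Proof.
apply/sub_kermxP/edge_space_sub => v w _; apply/sub_kermxP.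
exact: artin_relator_augmentation.
Qed.

Lemma fox_aeq u u' : aeq adj lt u u' -> (fox u - fox u' <= edge_space)%MS.
Proof.
elim=> {u u'} [u|u u' _ IH|u1 u2 u3 _ IH12 _ IH23|a b u u' uu' IH|v b|v w vw].
- by rewrite subrr sub0mx.
- by rewrite -opprB eqmx_opp.
- by rewrite -(subrKA (fox u2)) addmx_sub.
- have -> : fox (a ++ u ++ b) - fox (a ++ u' ++ b) = t ^ deg a *: (fox u - fox u').
    rewrite !fox_cat (chi_aeq m uu') opprD addrACA subrr add0r -scalerBr.
    by rewrite opprD addrACA subrr addr0.
  exact: scalemx_sub.
- by rewrite fox_free subr0 sub0mx.
- exact: artin_relator_sub.
Qed.

End FoxCalculus.

Section ResonanceGraph.
Variables (V : finType) (adj : rel V) (lt : V -> V -> nat) (m : V -> int).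
Variables (L : fieldType) (t : L).
Hypothesis t_neq0 : t != 0.
Hypothesis t_inf_order : forall k : int, t ^ k = 1 -> k = 0.
Hypothesis adj_sym : symmetric adj.
Hypothesis lt_sym : forall v w, adj v w -> lt v w = lt w v.
Hypothesis lt_gt0 : forall v w, adj v w -> (0 < lt v w)%N.
Local Notation VR := (VR m).
Local Notation V1 := (V1 adj m).
Local Notation E1 := (E1 adj lt m L).
Local Notation root := (fingraph.root E1).
Local Notation components := [predI roots E1 & V1].
Local Notation fox_gen := (@fox_gen V L).
Local Notation artin_factor := (artin_factor m t).
Local Notation artin_relator := (artin_relator m t).
Local Notation edge_space := (edge_space m t adj lt).

Lemma sub1_expz_eq0 v : (1 - t ^ m v == 0) = VR v.
Proof.
rewrite subr_eq0 eq_sym; apply/eqP/eqP => [/t_inf_order // | ->].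
exact: expr0z.
Qed.

Lemma E1_sym : symmetric E1.
Proof.
suff E1W v w : E1 v w -> E1 w v by move=> v w; apply/idP/idP; apply: E1W.
move=> /and5P[vw V1v V1w nVR nER]; apply/and5P; split=> //.
- by rewrite adj_sym.
- by rewrite andbC.
- by rewrite /ER addrC -lt_sym.
Qed.

Lemma E1_connect_sym : connect_sym E1.
Proof. exact: sym_connect_sym E1_sym. Qed.

Lemma V1_nonresonant v : ~~ VR v -> V1 v.
Proof. by rewrite /Defs.V1 => /negPf ->. Qed.

Lemma V1_resonant_adj v w : adj v w -> VR v -> ~~ VR w -> V1 v = false.
Proof.
move=> vw VRv nVRw; apply/negbF; rewrite VRv; apply/existsP; exists w.
by rewrite vw.
Qed.

Lemma E1_nonresonant v w : E1 v w -> ~~ VR v.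
Proof.
move=> /and5P[vw V1v _ nVR _]; apply/negP => VRv; move: nVR; rewrite VRv => nVRw.
by rewrite (V1_resonant_adj vw) in V1v.
Qed.

Lemma connect_V1 v w : connect E1 v w -> V1 v = V1 w.
Proof.
apply: (@closed_connect _ E1 V1) => {}v {}w /and5P[_ V1v V1w _ _].
by apply/idP/idP => _; [exact: V1w | exact: V1v].
Qed.

Lemma root_in_components v : V1 v -> root v \in components.
Proof.
move=> V1v; apply/andP; split; first exact: roots_root E1_connect_sym _.
by have := V1v; rewrite (connect_V1 (connect_root E1 v)).
Qed.

Definition weight v : L := if VR v then 1 else 1 - t ^ m v.

Lemma weight_neq0 v : weight v != 0.
Proof. by rewrite /weight; case: ifPn; rewrite ?oner_neq0 ?sub1_expz_eq0. Qed.

Definition unit_gen v : 'rV[L]_#|V| := (weight v)^-1 *: fox_gen v.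

Lemma fox_gen_unit v : fox_gen v = weight v *: unit_gen v.
Proof. by rewrite scalerA divff ?weight_neq0 ?scale1r. Qed.

Lemma artin_relator_weight v w n : ~~ VR v -> ~~ VR w ->
  artin_relator v w n =
  (artin_factor v w n * weight v * weight w) *: (unit_gen v - unit_gen w).
Proof.
move=> nVRv nVRw.
have weightE u : ~~ VR u -> 1 - t ^ m u = weight u by rewrite /weight => /negPf ->.
rewrite artin_relatorE // !weightE // -mulrA -scalerA; congr (_ *: _).
by rewrite scalerBr {1}[weight v * _]mulrC -!scalerA -!fox_gen_unit.
Qed.

Lemma artin_relator_resonant v w n :
  VR v -> artin_relator v w n = (artin_factor v w n * (1 - t ^ m w)) *: fox_gen v.
Proof.
rewrite -sub1_expz_eq0 => /eqP v0.
by rewrite artin_relatorE // v0 scale0r subr0 scalerA.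
Qed.

Lemma artin_relatorC v w n : artin_relator w v n = - artin_relator v w n.
Proof. by rewrite opprB. Qed.

Lemma artin_factor_edge_eq0 v w :
  adj v w -> (artin_factor v w (lt v w) == 0) = ER lt m L v w.
Proof. by move=> vw; apply: artin_factor_eq0 => //; apply: lt_gt0. Qed.

Definition component_mx : 'M[L]_(#|V|, #|components|) := \matrix_(i, j)
  (weight (enum_val i) *+
    (V1 (enum_val i) && (root (enum_val i) == enum_val j))).

Definition root_mx : 'M[L]_(#|components|, #|V|) :=
  \matrix_j unit_gen (enum_val j).

Lemma unit_gen_component v j : (unit_gen v *m component_mx) 0 j =
  (V1 v && (root v == enum_val j))%:R.
Proof.
rewrite -scalemxAl -rowE !mxE enum_rankK -[_ *+ _]mulr_natr mulrA.
by rewrite mulVf ?weight_neq0 // mul1r.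
Qed.

Lemma root_mxK : root_mx *m component_mx = 1%:M.
Proof.
apply/row_matrixP => j; rewrite row_mul rowK; apply/rowP => j'.
rewrite unit_gen_component !mxE.
have /andP[/eqP root_j V1j] : enum_val j \in components by exact: enum_valP.
by rewrite [V1 _]V1j root_j (inj_eq enum_val_inj).
Qed.

Lemma unit_gen_root_mx v : V1 v ->
  unit_gen v *m component_mx *m root_mx = unit_gen (root v).
Proof.
move=> V1v; have root_v := root_in_components V1v.
rewrite mulmx_sum_row (bigD1 (enum_rank_in root_v (root v))) //=.
rewrite unit_gen_component V1v rowK enum_rankK_in // eqxx scale1r.
rewrite big1 ?addr0 // => j /negP j_neq; rewrite unit_gen_component V1v /=.
have [vj | _] := eqVneq (root v) (enum_val j); last by rewrite scale0r.
by case: j_neq; apply/eqP/enum_val_inj; rewrite enum_rankK_in.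
Qed.

Lemma unit_gen_deleted v : V1 v = false -> unit_gen v *m component_mx = 0.
Proof. by move=> V1v; apply/rowP => j; rewrite unit_gen_component V1v mxE. Qed.

Lemma artin_relator_resonant_component v w n :
  adj v w -> VR v -> artin_relator v w n *m component_mx = 0.
Proof.
move=> vw VRv; rewrite artin_relator_resonant // fox_gen_unit -2!scalemxAl.
have [VRw | nVRw] := boolP (VR w).
  by have /eqP -> : 1 - t ^ m w == 0; rewrite ?sub1_expz_eq0 // mulr0 scale0r.
by rewrite unit_gen_deleted ?scaler0 // (V1_resonant_adj vw).
Qed.

Lemma artin_relator_component v w :
  adj v w -> artin_relator v w (lt v w) *m component_mx = 0.
Proof.
move=> vw; have [VRv | nVRv] := boolP (VR v).
  exact: artin_relator_resonant_component.
have [VRw | nVRw] := boolP (VR w).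
  rewrite -[artin_relator _ _ _]opprK -artin_relatorC mulNmx.
  by rewrite artin_relator_resonant_component ?oppr0 1?adj_sym.
rewrite artin_relator_weight // -scalemxAl mulmxBl.
have [ERvw | nER] := boolP (ER lt m L v w).
  have /eqP -> : artin_factor v w (lt v w) == 0 by rewrite artin_factor_edge_eq0.
  by rewrite !mul0r scale0r.
have E1vw : E1 v w by rewrite /Defs.E1 vw !V1_nonresonant // (negPf nVRv) nER.
have root_vw := fingraph.rootP E1_connect_sym (connect1 E1vw).
rewrite (_ : unit_gen v *m _ = unit_gen w *m component_mx) ?subrr ?scaler0 //.
apply/rowP => j; rewrite !unit_gen_component root_vw.
by rewrite (connect_V1 (connect1 E1vw)).
Qed.

Lemma edge_space_edge v w : E1 v w -> (unit_gen v - unit_gen w <= edge_space)%MS.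
Proof.
move=> E1vw; have /and5P[vw _ _ _ nER] := E1vw.
have nVRv := E1_nonresonant E1vw.
have nVRw : ~~ VR w by apply: (@E1_nonresonant w v); rewrite E1_sym.
have := artin_relator_sub m t lt vw; rewrite artin_relator_weight //.
by rewrite eqmx_scale // !mulf_neq0 ?weight_neq0 // artin_factor_edge_eq0.
Qed.

Lemma edge_space_connect v w :
  connect E1 v w -> (unit_gen v - unit_gen w <= edge_space)%MS.
Proof.
move=> /connectP[p]; elim: p v => [|u p IH] v /=.
  by move=> _ ->; rewrite subrr sub0mx.
move=> /andP[vu up] w_last; rewrite -(subrKA (unit_gen u)) addmx_sub //.
  exact: edge_space_edge.
exact: IH.
Qed.

Lemma edge_space_deleted v : ~~ V1 v -> (unit_gen v <= edge_space)%MS.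
Proof.
rewrite negbK => /andP[VRv /existsP[w /andP[vw nVRw]]].
apply: scalemx_sub; have := artin_relator_sub m t lt vw.
rewrite artin_relator_resonant // eqmx_scale // mulf_neq0 ?sub1_expz_eq0 //.
by rewrite artin_factor_edge_eq0 // /ER (eqP VRv) add0r [m w == 0](negPf nVRw).
Qed.

Lemma edge_space_unit_gen v :
  (unit_gen v *m (1%:M - component_mx *m root_mx) <= edge_space)%MS.
Proof.
rewrite mulmxBr mulmx1 mulmxA; have [V1v | /negbTE V1v] := boolP (V1 v).
  by rewrite unit_gen_root_mx //; apply/edge_space_connect/connect_root.
rewrite unit_gen_deleted // mul0mx subr0.
by apply: edge_space_deleted; rewrite V1v.
Qed.

Lemma edge_space_kermx : (edge_space :=: kermx component_mx)%MS.
Proof.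
apply/eqmxP/andP; split.
  apply: edge_space_sub => v w vw; apply/sub_kermxP.
  exact: artin_relator_component.
pose P : 'M_#|V| := 1%:M - component_mx *m root_mx.
have -> : kermx component_mx = kermx component_mx *m P.
  by rewrite mulmxBr mulmx1 mulmxA mulmx_ker mul0mx subr0.
apply: submx_trans (submxMl _ _) _; apply/row_subP => i.
have -> : row i P = weight (enum_val i) *: (unit_gen (enum_val i) *m P).
  by rewrite rowE scalemxAl -fox_gen_unit /fox_gen enum_valK.
exact/scalemx_sub/edge_space_unit_gen.
Qed.

Lemma rank_edge_space : \rank edge_space = (#|V| - ncomp_Gamma1 adj lt m L)%N.
Proof.
rewrite edge_space_kermx mxrank_ker.
suff /eqP -> : row_full component_mx by [].
by apply/row_fullP; exists root_mx; apply: root_mxK.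
Qed.

Lemma ncomp_Gamma1_le : (ncomp_Gamma1 adj lt m L <= #|V|)%N.
Proof. exact: max_card. Qed.

Lemma ncomp_Gamma1_gt0 v : ~~ VR v -> (0 < ncomp_Gamma1 adj lt m L)%N.
Proof.
by move=> /V1_nonresonant/root_in_components v1; apply/card_gt0P; exists (root v).
Qed.

End ResonanceGraph.

Lemma rank_adds_rV (L : fieldType) k n (A : 'M[L]_(k, n)) (v : 'rV_n) :
  ~~ (v <= A)%MS -> \rank (A + v)%MS = (\rank A).+1.
Proof.
move=> vA; apply/eqP; rewrite eqn_leq; apply/andP; split; last first.
  by apply: rank_ltmx; rewrite ltmxE addsmxSl addsmx_sub submx_refl.
apply: leq_trans (mxrank_adds_leqif A v) _.
by rewrite -[leqRHS]addn1 leq_add2l rank_leq_row.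
Qed.

Section FractionsOfPolynomials.
Variable R : idomainType.
Local Notation t := (@FracField.tofrac {poly R} 'X).

Lemma tofracX_neq0 : t != 0.
Proof. by rewrite tofrac_eq0 polyX_eq0. Qed.

Lemma tofracX_inf_order (k : int) : t ^ k = 1 -> k = 0.
Proof.
have nat_order n : t ^+ n = 1 -> n = 0%N.
  rewrite -tofracXn -tofrac1 => /eqP; rewrite tofrac_eq => /eqP.
  move=> /(congr1 (fun p : {poly R} => size p)).
  by rewrite size_polyXn size_poly1 => -[].
case: k => n; first by move/nat_order ->.
by rewrite NegzE -exprnN => /eqP; rewrite invr_eq1 => /eqP/nat_order.
Qed.

End FractionsOfPolynomials.

Section HomologyPresentation.
Variables (V : finType) (adj : rel V) (lt : V -> V -> nat) (m : V -> int).
Variables (K : fieldType) (g : word V).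
Hypothesis chi_g : chi m g = 1.
Local Notation R := {poly K}.
Local Notation F := {fraction R}.
Local Notation tofrac := (@FracField.tofrac R).
Local Notation t := (tofrac 'X).
Local Notation "u ~ w" := (aeq adj lt u w) (at level 70).
Local Notation H1 := (H1 adj lt m K g).
Local Notation word_class := (word_class adj lt m K g).
Local Notation kernel_part := (@kernel_part V m K).
Local Notation h1_null := (@h1_null V adj lt m K).
Local Notation conj_g := (@conj_map V K g).
Local Notation fox := (@fox V m F t).
Implicit Types (u : word V) (v w : V).

Definition kernel_word u : word V := u ++ winv (wpowz g (chi m u)).

Lemma chi_kernel_word u : chi m (kernel_word u) = 0.
Proof. by rewrite chi_cat chi_winv chi_wpowz chi_g mul1r subrr. Qed.

Lemma kernel_word_id u : chi m u = 0 -> kernel_word u = u.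
Proof. by rewrite /kernel_word => ->; rewrite cats0. Qed.

Lemma kernel_word_g : kernel_word g ~ [::].
Proof. by rewrite /kernel_word chi_g /= /wpow /= cats0; apply: aeq_mulwV. Qed.

Lemma kernel_word_aeq u u' : u ~ u' -> kernel_word u ~ kernel_word u'.
Proof. by move=> uu'; rewrite /kernel_word (chi_aeq m uu'); apply: aeq_catr. Qed.

Lemma kernel_word_cat u u' :
  kernel_word u ++ wconj (wpowz g (chi m u)) (kernel_word u') ~ kernel_word (u ++ u').
Proof.
rewrite /kernel_word /wconj -!catA chi_cat; apply: aeq_catl; rewrite catA.
apply: (@aeq_trans _ _ _ _ (u' ++ winv (wpowz g (chi m u')) ++
  winv (wpowz g (chi m u)))); first exact: (aeq_catr _ (aeq_mulVw _ _ _)).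
rewrite -winv_cat; apply: aeq_catl; apply: aeq_winv; exact: aeq_wpowzD.
Qed.

Lemma word_class_kernel_cat u u' : word_class (kernel_word (u ++ u')) =
  word_class (kernel_word u) +
  word_class (wconj (wpowz g (chi m u)) (kernel_word u')).
Proof.
rewrite -word_class_cat ?chi_wconj ?chi_kernel_word //.
exact/esym/word_class_aeq/kernel_word_cat.
Qed.

Definition kernel_gen (i : 'I_#|V|) : H1 :=
  word_class (kernel_word [:: (enum_val i, false)]).

Lemma frac_coord_wconj k u q :
  frac_coord kernel_gen (word_class u) q ->
  frac_coord kernel_gen (word_class (wconj (wpowz g k) u)) (t ^ k *: q).
Proof.
have conjS j : 'X *: word_class (wconj (wpowz g j) u) =
    word_class (wconj (wpowz g (j + 1)) u).
  rewrite -word_class_conj -wconj_cat; apply: word_class_aeq.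
  apply: aeq_wconj; [exact: aeq_wpowz_succ | exact: aeq_refl].
move=> uq; elim: k => [|n IH|n IH].
- by rewrite expr0z scale1r /wconj /= cats0.
- rewrite intS addrC -conjS expfzDr ?tofracX_neq0 // mulrC -scalerA.
  exact: frac_coordZ.
- apply: (@frac_coordZK _ _ _ _ 'X); first by rewrite polyX_eq0.
  rewrite conjS scalerA -[X in X * _]expr1z -expfzDr ?tofracX_neq0 //.
  by rewrite [1 + _]addrC intS opprD addrAC addNr add0r.
Qed.

Lemma frac_coord_fox u :
  frac_coord kernel_gen (word_class (kernel_word u)) (fox u).
Proof.
have gen v : frac_coord kernel_gen (word_class (kernel_word [:: (v, false)]))
    (fox_gen F v).
  by have := frac_coord_gen kernel_gen (enum_rank v); rewrite /kernel_gen enum_rankK.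
have letter l : frac_coord kernel_gen (word_class (kernel_word [:: l]))
    (fox_letter m t l).
  case: l => v []; last exact: gen.
  have := word_class_kernel_cat [:: (v, true)] [:: (v, false)].
  rewrite (word_class_aeq _ _ _ (kernel_word_aeq (aeq_free adj lt v true))).
  rewrite kernel_word_id ?chi_nil // word_class_nil => /esym/eqP.
  rewrite addr_eq0 => /eqP ->; rewrite /fox_letter scaleNr chi1.
  exact/frac_coordN/frac_coord_wconj/gen.
elim: u => [|l u IH].
  by rewrite kernel_word_id ?chi_nil // word_class_nil; apply: frac_coord0.
rewrite -cat1s word_class_kernel_cat; apply: frac_coordD; first exact: letter.
exact: frac_coord_wconj.
Qed.

Lemma kernel_gen_generates (y : H1) : exists q, frac_coord kernel_gen y q.
Proof.
have [c c_chain <-] := chain_class_surj y; rewrite chain_class_sum.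
elim: c c_chain => [_|[a u] c IH /andP[/eqP u0 /IH[q cq]]].
  by exists 0; rewrite big_nil; apply: frac_coord0.
exists (tofrac a%:P *: fox u + q); rewrite big_cons; apply: frac_coordD cq.
by apply: frac_coordZ; rewrite -(kernel_word_id u0); apply: frac_coord_fox.
Qed.

Local Notation edge_space := (edge_space m t adj lt).
Local Notation relation_space := (edge_space + fox g)%MS.

Lemma relation_space_frac_coord q :
  (q <= relation_space)%MS -> frac_coord kernel_gen 0 q.
Proof.
have relator v w : adj v w ->
    frac_coord kernel_gen 0 (artin_relator m t v w (lt v w)).
  move=> vw; have := frac_coordB (frac_coord_fox (artin_rel v w (lt v w)))
    (frac_coord_fox (artin_rel w v (lt v w))).
  by rewrite (word_class_aeq _ _ _ (kernel_word_aeq (aeq_artin lt vw))) subrr.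
have fox_g : frac_coord kernel_gen 0 (fox g).
  have := frac_coord_fox g; rewrite (word_class_aeq _ _ _ kernel_word_g).
  by rewrite word_class_nil.
move=> /sub_addsmxP[[a b] ->] /=; rewrite -[0]addr0; apply: frac_coordD.
  apply: frac_coord0_sums (submxMl _ _) => e; exact: relator.
exact: frac_coord0_rV (submxMl _ _) fox_g.
Qed.

Local Notation fox_quotient := (restrict_scalars (tofrac \o polyC) 'rV[F]_#|V|).

(* It vanishes on the relations of [H1], and so detects that the generators
   satisfy no relation outside [relation_space]. *)
Definition fox_functional : {freeg (word V) / K} -> fox_quotient :=
  @fglift K fox_quotient (word V)
    (fun u => if chi m u == 0 then fox u *m cokermx relation_space else 0).
HB.instance Definition _ := GRing.Linear.on fox_functional.

Lemma fox_functionalU u : chi m u = 0 ->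
  fox_functional << u >> = fox u *m cokermx relation_space.
Proof. by move=> u0; rewrite [LHS]fgliftU1 u0 eqxx. Qed.

Lemma fox_functional_kernel_part x :
  fox_functional (kernel_part x) = fox_functional x.
Proof.
apply: (@freeg_linear_eq _ _ _ (fox_functional \o kernel_part)) => u /=.
rewrite kernel_partU [RHS]fgliftU1; case: eqP => u0; last by rewrite linear0.
exact: fox_functionalU.
Qed.

Lemma fox_functional_null x : x \in h1_null -> fox_functional x = 0.
Proof.
move=> /h1_nullP; rewrite -fox_functional_kernel_part.
elim/h1_relation_ind: {x}(kernel_part x) /
  => [|x y x0 y0|a x x0|u u' u0 u'0|u u' u0 uu'].
- exact: linear0.
- by rewrite linearD /= x0 y0 addr0.
- by rewrite linearZ_LR /= x0 scaler0.
- rewrite linearB linearD /= !fox_functionalU ?chi_cat ?u0 ?u'0 ?addr0 //.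
  by rewrite fox_cat ?tofracX_neq0 // u0 expr0z scale1r mulmxDl subrr.
- rewrite linearB /= !fox_functionalU -?(chi_aeq m uu') // -mulmxBl; apply/eqP.
  rewrite -submxE; apply: submx_trans (addsmxSl _ _).
  by apply: fox_aeq => //; apply: tofracX_neq0.
Qed.

Lemma fox_functional_conj x :
  fox_functional (conj_g x) = t *: (fox_functional x : 'rV_#|V|).
Proof.
rewrite -[x]Freeg_enum freeg_sum 2!linear_sum [fox_functional _ in RHS]linear_sum.
rewrite scaler_sumr; apply: eq_bigr => p _ /=.
have -> : conj_g (p.1 *: << p.2 >>) = p.1 *: << wconj g p.2 >>.
  by rewrite linearZ /= conj_mapU.
rewrite !(linearZ_LR fox_functional) /=.
rewrite !restrict_scalarsE scalerA mulrC -scalerA; congr (_ *: _).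
rewrite [LHS]fgliftU1 [fox_functional _ in RHS]fgliftU1 chi_wconj.
case: eqP => u0; last by rewrite scaler0.
by rewrite fox_wconj ?tofracX_neq0 // chi_g expr1z -scalemxAl.
Qed.

Lemma fox_functionalZ (p : R) (x : poly_module conj_g) :
  fox_functional (p *: x) = tofrac p *: (fox_functional x : 'rV_#|V|).
Proof.
apply: (@poly_module_semilinear _ _ conj_g F tofrac 'rV[F]_#|V| fox_functional).
  exact: (linearZ_LR fox_functional).
exact: fox_functional_conj.
Qed.

Lemma fox_functional_kernel_gen v :
  fox_functional << kernel_word [:: (v, false)] >> =
  row (enum_rank v) (cokermx relation_space).
Proof.
rewrite fox_functionalU ?chi_kernel_word // fox_cat ?tofracX_neq0 // fox1.
rewrite mulmxDl -rowE -[RHS]addr0; congr (_ + _); apply/eqP; rewrite -submxE.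
apply: submx_trans (addsmxSr _ _); apply: scalemx_sub.
exact: submx_trans (fox_winv_sub _ (tofracX_neq0 K) _)
  (fox_wpowz_sub _ (tofracX_neq0 K) _ _).
Qed.

Lemma frac_coord_relation_space q :
  frac_coord kernel_gen 0 q -> (q <= relation_space)%MS.
Proof.
move=> [p [a [p0 aE]]]; rewrite scaler0 => /esym sum0.
pose x (i : 'I_#|V|) : poly_module conj_g := << kernel_word [:: (enum_val i, false)] >>.
pose y : poly_module conj_g := \sum_i a 0 i *: x i.
have /fox_functional_null y0 : y \in h1_null.
  apply/(@h1_class_eq0 V adj lt m K g); rewrite linear_sum -[RHS]sum0.
  by apply: eq_bigr => i _; rewrite linearZ.
have : (map_mx tofrac a <= relation_space)%MS.
  rewrite submxE mulmx_sum_row -[X in _ == X]y0 [fox_functional y]linear_sum.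
  apply/eqP/eq_bigr => i _.
  by rewrite /= fox_functionalZ fox_functional_kernel_gen enum_valK mxE.
by rewrite aE eqmx_scale // tofrac_eq0.
Qed.

Hypothesis adj_sym : symmetric adj.
Hypothesis lt_sym : forall v w, adj v w -> lt v w = lt w v.
Hypothesis lt_gt0 : forall v w, adj v w -> (0 < lt v w)%N.
Local Notation ncomp := (ncomp_Gamma1 adj lt m F).

Lemma rank_relation_space : \rank relation_space = (\rank edge_space).+1.
Proof.
have fox_g_notin : ~~ (fox g <= edge_space)%MS.
  apply/negP => /submxP[a fox_gE].
  have := fox_fundamental_formula m (tofracX_neq0 K) g.
  rewrite fox_gE -mulmxA edge_space_augmentation ?tofracX_neq0 // mulmx0 chi_g.
  move/rowP/(_ 0)/esym/eqP; rewrite !mxE expr1z subr_eq0 eq_sym -[t]expr1z.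
  by move/eqP/tofracX_inf_order.
exact: rank_adds_rV.
Qed.

Lemma rank_H1 : module_rank_is H1 (ncomp - 1).
Proof.
have -> : (ncomp - 1)%N = (#|V| - \rank relation_space)%N.
  rewrite rank_relation_space rank_edge_space ?tofracX_neq0 //; last first.
    exact: tofracX_inf_order.
  by rewrite [RHS]subnS subKn ?subn1 ?ncomp_Gamma1_le.
apply: (presentation_rank kernel_gen_generates) => q.
split; [exact: frac_coord_relation_space | exact: relation_space_frac_coord].
Qed.

End HomologyPresentation.

Section Rescaling.
Variables (V : finType) (adj : rel V) (lt : V -> V -> nat).
Implicit Types (m d : V -> int) (K : fieldType) (a : int).

Lemma chi_scale d a (u : word V) : chi (fun v => d v * a) u = chi d u * a.
Proof.
by rewrite /chi mulr_suml; apply: eq_bigr => -[v []] _ //=; rewrite mulNr.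
Qed.

Lemma normalized_degree m g :
  (exists v, m v != 0) -> (forall u : word V, (chi m g %| chi m u)%Z) ->
  exists d a, [/\ a != 0, m = (fun v => d v * a) & chi d g = 1].
Proof.
move=> [v mv] chi_g_dvd; pose a := chi m g; pose d v := (m v %/ a)%Z.
have dvd_m w : (a %| m w)%Z by rewrite -(chi1 m w false) chi_g_dvd.
have a_neq0 : a != 0.
  by apply: contraNneq mv => a0; rewrite -dvd0z -a0.
have mE : m = (fun v => d v * a) by apply/funext => w; rewrite divzK.
exists d, a; split=> //; apply: (mulIf a_neq0).
by rewrite -chi_scale -mE mul1r.
Qed.

Section EqualKernels.
Variables (K : fieldType) (m d : V -> int).
Hypothesis same_kernel : forall u : word V, (chi m u == 0) = (chi d u == 0).

Lemma is_chain_eq_kernel : @is_chain V m K = @is_chain V d K.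
Proof. by apply/funext => c; apply: eq_all => p; rewrite same_kernel. Qed.

Lemma h1rel_eq_kernel (c : chain V K) : h1rel adj lt m c -> h1rel adj lt d c.
Proof.
have kernel u : chi m u = 0 -> chi d u = 0.
  by move/eqP; rewrite same_kernel => /eqP.
elim=> [|b u w /kernel u0 /kernel w0|b u w /kernel u0 uw|r1 r2 _ IH1 _ IH2].
- exact: h1rel_nil.
- exact: h1rel_mul.
- exact: h1rel_eq.
- exact: h1rel_cat.
Qed.

End EqualKernels.

Lemma h1zero_eq_kernel K m d :
  (forall u : word V, (chi m u == 0) = (chi d u == 0)) ->
  @h1zero V adj lt m K = @h1zero V adj lt d K.
Proof.
move=> same_kernel; apply/funext => c; apply/propext.
by split=> -[r [rr cr]]; exists r; split=> //; apply: h1rel_eq_kernel rr => u;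
  rewrite same_kernel.
Qed.

Section Scale.
Variables (K : fieldType) (d : V -> int) (a : int).
Hypothesis a_neq0 : a != 0.
Local Notation da := (fun v => d v * a).

Let same_kernel (u : word V) : (chi da u == 0) = (chi d u == 0).
Proof. by rewrite chi_scale mulf_eq0 (negPf a_neq0) orbF. Qed.

Lemma h1_rank_is_scale : h1_rank_is adj lt da K = h1_rank_is adj lt d K.
Proof.
by rewrite /h1_rank_is /h1_independent (is_chain_eq_kernel K same_kernel)
  (h1zero_eq_kernel K same_kernel).
Qed.

Lemma h1_torsion_scale : h1_torsion adj lt da K = h1_torsion adj lt d K.
Proof.
by rewrite /h1_torsion (is_chain_eq_kernel K same_kernel)
  (h1zero_eq_kernel K same_kernel).
Qed.

Lemma ncomp_Gamma1_scale : ncomp_Gamma1 adj lt da K = ncomp_Gamma1 adj lt d K.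
Proof.
have VR_scale : VR da = VR d.
  by apply/funext => v; rewrite /VR mulf_eq0 (negPf a_neq0) orbF.
have ER_scale : ER lt da K = ER lt d K.
  apply/funext => v; apply/funext => w.
  by rewrite /ER -mulrDl mulf_eq0 (negPf a_neq0) orbF.
by rewrite /ncomp_Gamma1 /E1 /V1 VR_scale ER_scale.
Qed.

End Scale.

Lemma ncomp_Gamma1_rmorph K (L : fieldType) (s : {rmorphism K -> L}) m :
  ncomp_Gamma1 adj lt m L = ncomp_Gamma1 adj lt m K.
Proof.
have ER_rmorph : ER lt m L = ER lt m K.
  apply/funext => v; apply/funext => w.
  by rewrite /ER -(rmorph_nat s) fmorph_eq0.
by rewrite /ncomp_Gamma1 /E1 ER_rmorph.
Qed.

End Rescaling.

Theorem theorem4p1 (V : finType) (adj : rel V) (lt : V -> V -> nat)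
    (K : fieldType) (m : V -> int) (g : word V) :
  irreflexive adj -> symmetric adj ->
  (forall v w, adj v w -> lt v w = lt w v) ->
  (forall v w, adj v w -> (0 < lt v w)%N) ->
  (exists v, m v != 0) ->
  (forall w : word V, (chi m g %| chi m w)%Z) ->
  h1_rank_is adj lt m K g (ncomp_Gamma1 adj lt m K - 1) /\
  (h1_torsion adj lt m K g <-> ncomp_Gamma1 adj lt m K = 1%N).
Proof.
move=> _ adj_sym lt_sym lt_gt0 [v0 mv0] chi_g_dvd.
have ncomp_gt0 : (0 < ncomp_Gamma1 adj lt m K)%N by apply: ncomp_Gamma1_gt0 mv0.
have [|d [a [a_neq0 mE d_g]]] := normalized_degree _ chi_g_dvd; first by exists v0.
rewrite mE h1_rank_is_scale // h1_torsion_scale // in ncomp_gt0 *.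
rewrite ncomp_Gamma1_scale // in ncomp_gt0 *.
rewrite -(ncomp_Gamma1_rmorph _ _ (@FracField.tofrac {poly K} \o polyC)) in ncomp_gt0 *.
have rankH1 := rank_H1 K d_g adj_sym lt_sym lt_gt0.
split; first exact/h1_rank_isP.
rewrite h1_torsionP (torsion_module_rank rankH1).
by split=> [|-> //]; case: ncomp_Gamma1 ncomp_gt0 => [|[]].
Qed.
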